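(* For $b,c\in\mathbb{R}$ let $E_{1,r}(b,c)$ (with $bc\neq 1$), $E_{2,r}(b)$, $E_{3,r},\dots,E_{7,r}$ be the 2-dimensional real evolution algebras with the matrices of structure constants given in the context. The following equalities hold: \[\mathrm{Der}(E_{1,r}(b,c))=\{0\},\qquad \mathrm{Der}(E_{2,r}(b))=\{0\}\ \text{ if } b\ne0,\] \[\mathrm{Der}(E_{2,r}(0))=\left\{\begin{pmatrix}0&0\\ t&-t\end{pmatrix}:\ t\in\mathbb{R}\right\},\qquad \mathrm{Der}(E_{3,r})=\mathrm{Der}(E_{4,r})=\mathrm{Der}(E_{5,r})=\{0\},\] \[\mathrm{Der}(E_{6,r})=\left\{\begin{pmatrix}-t&t\\ t&-t\end{pmatrix}:\ t\in\mathbb{R}\right\},\qquad \mathrm{Der}(E_{7,r})=\left\{\begin{pmatrix}2t&s\\ 0&t\end{pmatrix}:\ t,s\in\mathbb{R}\right\}.\]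
   Context: A 2-dimensional real algebra is given, with respect to a basis $(e_1,e_2)$, by its $2\times4$ matrix of structure constants (MSC) $E$, whose columns are, in order, the coordinate columns of $e_1e_1,\ e_1e_2,\ e_2e_1,\ e_2e_2$. For an algebra with MSC $E$, its algebra of derivations is presented as \[\mathrm{Der}(E)=\{D\in Mat(2\times2;\mathbb{R}):\ E(D\otimes I+I\otimes D)-DE=0\},\] where $\otimes$ is the Kronecker product and $I$ is the $2\times2$ identity matrix. The algebras are \[E_{1,r}(b,c)=\begin{pmatrix}1&0&0&b\\ c&0&0&1\end{pmatrix}\ (bc\ne1),\quad E_{2,r}(b)=\begin{pmatrix}1&0&0&b\\ 1&0&0&0\end{pmatrix},\quad E_{3,r}=\begin{pmatrix}0&0&0&1\\ 1&0&0&0\end{pmatrix},\] \[E_{4,r}=\begin{pmatrix}1&0&0&1\\ 0&0&0&0\end{pmatrix},\quad E_{5,r}=\begin{pmatrix}1&0&0&-1\\ 0&0&0&0\end{pmatrix},\quad E_{6,r}=\begin{pmatrix}1&0&0&-1\\ -1&0&0&1\end{pmatrix},\quad E_{7,r}=\begin{pmatrix}0&0&0&1\\ 0&0&0&0\end{pmatrix}.\] *)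

(* Defs.v *)
From mathcomp Require Import all_boot all_order all_algebra.
From mathcomp Require Import classical_sets reals.
From mathcomp.real_closed Require Import mxtens.

Set Implicit Arguments.
Unset Strict Implicit.
Unset Printing Implicit Defensive.

Import GRing.Theory.
Local Open Scope ring_scope.
Local Open Scope classical_set_scope.

Definition mx_of_rows (R : nzRingType) (m n : nat) (rows : seq (seq R)) :
    'M[R]_(m, n) :=
  \matrix_(i, j) (nth [::] rows i)`_j.

(* The four columns of a matrix of structure constants are the coordinates of
   e1e1, e1e2, e2e1, e2e2, i.e. the column of e_(i+1) e_(j+1) has index
   2 * i + j = mxtens_index (i, j), which is the ordering used by [*t]. *)
Definition MSC (R : nzRingType) := 'M[R]_(2, 2 * 2).

Definition Der (R : realType) (E : MSC R) : set 'M[R]_2 :=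
  [set D | E *m (D *t 1%:M + 1%:M *t D) - D *m E = 0].

Definition mx22 (R : nzRingType) (a b c d : R) : 'M[R]_2 :=
  mx_of_rows 2 2 [:: [:: a; b]; [:: c; d]].

Definition E1r (R : realType) (b c : R) : MSC R :=
  mx_of_rows 2 (2 * 2) [:: [:: 1; 0; 0; b]; [:: c; 0; 0; 1]].
Definition E2r (R : realType) (b : R) : MSC R :=
  mx_of_rows 2 (2 * 2) [:: [:: 1; 0; 0; b]; [:: 1; 0; 0; 0]].
Definition E3r (R : realType) : MSC R :=
  mx_of_rows 2 (2 * 2) [:: [:: 0; 0; 0; 1]; [:: 1; 0; 0; 0]].
Definition E4r (R : realType) : MSC R :=
  mx_of_rows 2 (2 * 2) [:: [:: 1; 0; 0; 1]; [:: 0; 0; 0; 0]].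
Definition E5r (R : realType) : MSC R :=
  mx_of_rows 2 (2 * 2) [:: [:: 1; 0; 0; -1]; [:: 0; 0; 0; 0]].
Definition E6r (R : realType) : MSC R :=
  mx_of_rows 2 (2 * 2) [:: [:: 1; 0; 0; -1]; [:: -1; 0; 0; 1]].
Definition E7r (R : realType) : MSC R :=
  mx_of_rows 2 (2 * 2) [:: [:: 0; 0; 0; 1]; [:: 0; 0; 0; 0]].

(* Main.v *)
Require Import Defs.
From mathcomp Require Import all_boot all_order all_algebra.
From mathcomp Require Import classical_sets reals.
From mathcomp Require Import ring lra.
From mathcomp.real_closed Require Import mxtens.

Import GRing.Theory.
Local Open Scope ring_scope.
Local Open Scope classical_set_scope.

Lemma forall_ord2 (P : 'I_2 -> Prop) : (forall i, P i) <-> P 0 /\ P 1.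
Proof.
split=> [//|[P0 P1] i].
by have [->|->] : i = 0 \/ i = 1 by case: i => [[|[|]]] // ?; [left|right]; apply: val_inj.
Qed.

Lemma mx22P (R : nzRingType) (A : 'M[R]_2) (a b c d : R) :
  A = mx22 a b c d <-> [/\ A 0 0 = a, A 0 1 = b, A 1 0 = c & A 1 1 = d].
Proof.
split=> [->|[<- <- <- <-]]; first by rewrite !mxE.
by apply/matrixP; apply/forall_ord2; split; apply/forall_ord2; split; rewrite mxE.
Qed.

(** [mxtens_index] is a bijection from pairs to product indices. Splitting the sum this way lets
    [tensmxE] evaluate Kronecker products entrywise. *)
Lemma sum_mxtens_index (R : nzRingType) (m n : nat) (F : 'I_(m * n) -> R) :
  \sum_k F k = \sum_i \sum_j F (mxtens_index (i, j)).
Proof.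
rewrite pair_big /= (reindex (@mxtens_index m n)) /=.
  by apply: eq_bigr => -[].
exists (@mxtens_unindex m n) => ? _; [exact: mxtens_indexK | exact: mxtens_unindexK].
Qed.

(** Read at row [i] and column [(j, k)], the matrix equation is the [i]-th coordinate of the Leibniz
    rule $D(e_j)e_k + e_jD(e_k) = D(e_je_k)$, the columns of [D] being the images of the basis
    vectors. *)
Lemma DerP (R : realType) (E : MSC R) (D : 'M[R]_2) :
  Der E D <-> forall i j k : 'I_2,
    (\sum_l D l j * E i (mxtens_index (l, k))) +
    (\sum_l D l k * E i (mxtens_index (j, l))) =
    \sum_l D i l * E l (mxtens_index (j, k)).
Proof.
have entry i j k : (E *m (D *t 1%:M + 1%:M *t D)) i (mxtens_index (j, k)) =
    (\sum_l D l j * E i (mxtens_index (l, k))) +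
    (\sum_l D l k * E i (mxtens_index (j, l))).
  rewrite mxE sum_mxtens_index.
  under eq_bigr => l _ do under eq_bigr => l' _ do
    rewrite mxE !tensmxE !mxE mulrDr.
  under eq_bigr => l _ do rewrite big_split /=.
  rewrite big_split /=; congr (_ + _).
    (* The identity factor of [D *t 1%:M] kills every term with [l' != k]; in the other summand it
       kills those with [l != j]. *)
    apply: eq_bigr => l _; rewrite (bigD1 k) //= eqxx mulr1 mulrC big1 ?addr0 //.
    by move=> l' /negbTE->; rewrite !mulr0.
  rewrite (bigD1 j) //= [X in _ + X]big1 ?addr0.
    by apply: eq_bigr => l _; rewrite eqxx mul1r mulrC.
  by move=> l /negbTE ->; rewrite big1 // => l' _; rewrite mul0r mulr0.
split=> [/eqP|DerD].
  by rewrite subr_eq0 => /eqP/matrixP DerD i j k; rewrite -entry DerD mxE.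
apply/eqP; rewrite subr_eq0; apply/eqP/matrixP => i jk.
by rewrite -(mxtens_unindexK jk); case: (mxtens_unindex jk) => j k; rewrite entry mxE.
Qed.

(* For the algebra e1e1 = a e1 + c e2, e2e2 = b e1 + d e2, e1e2 = e2e1 = 0,
   the two equations of each line say that D is a derivation on e1e1, on e1e2
   and on e2e2; the condition on e2e1 is the same as that on e1e2. *)
Lemma Der_evolutionP (R : realType) (a b c d : R) (D : 'M[R]_2) :
  Der (mx_of_rows 2 (2 * 2) [:: [:: a; 0; 0; b]; [:: c; 0; 0; d]]) D <->
  [/\ a * D 0 0 = c * D 0 1 /\ 2 * c * D 0 0 = a * D 1 0 + c * D 1 1,
      a * D 0 1 + b * D 1 0 = 0 /\ c * D 0 1 + d * D 1 0 = 0 &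
      2 * b * D 1 1 = b * D 0 0 + d * D 0 1 /\ d * D 1 1 = b * D 1 0].
Proof.
rewrite DerP !forall_ord2 !big_ord_recl !big_ord0 !mxE /=.
have -> : lift ord0 ord0 = 1 :> 'I_2 by apply: val_inj.
rewrite -[ord0]/(0 : 'I_2).
split; first by move=> [[[? ?] [? ?]] [[? ?] [? ?]]]; do !split; lra.
by move=> [[? ?] [? ?] [? ?]]; do !split; lra.
Qed.

Lemma mx22_0 (R : nzRingType) : 0 = mx22 0 0 0 0 :> 'M[R]_2.
Proof. by apply/mx22P; rewrite !mxE. Qed.

(** Replaces the entries of [D] by scalar variables [p q r s], in row order. The system is
    homogeneous, so [0] always solves it and only uniqueness has to be supplied. *)
Lemma Der_evolution_eq0 (R : realType) (a b c d : R) :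
  (forall p q r s : R,
    [/\ a * p = c * q /\ 2 * c * p = a * r + c * s,
        a * q + b * r = 0 /\ c * q + d * r = 0 &
        2 * b * s = b * p + d * q /\ d * s = b * r] ->
    [/\ p = 0, q = 0, r = 0 & s = 0]) ->
  Der (mx_of_rows 2 (2 * 2) [:: [:: a; 0; 0; b]; [:: c; 0; 0; d]]) = [set 0].
Proof.
move=> sol0; rewrite eqEsubset; split=> [D /Der_evolutionP/sol0|_ ->].
  by rewrite /set1 /= mx22_0 => /mx22P.
by apply/Der_evolutionP; rewrite !mxE !mulr0 !addr0.
Qed.

Theorem theorem3p5 (R : realType) :
  (forall b c : R, b * c <> 1 -> Der (E1r b c) = [set 0]) /\
  (forall b : R, b <> 0 -> Der (E2r b) = [set 0]) /\
  Der (E2r (0 : R)) = [set D | exists t : R, D = mx22 0 0 t (- t)] /\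
  Der (E3r R) = [set 0] /\
  Der (E4r R) = [set 0] /\
  Der (E5r R) = [set 0] /\
  Der (E6r R) = [set D | exists t : R, D = mx22 (- t) t t (- t)] /\
  Der (E7r R) = [set D | exists t s : R, D = mx22 (2 * t) s 0 t].
Proof.
split.
  move=> b c bc1; apply: Der_evolution_eq0 => p q r s.
  move=> [[h1 h2] [h3 h4] [h5 h6]].
  have r0 : r = 0.
    (* Cramer's rule: [h3] and [h4] form a linear system in [q] and [r] with determinant
       [1 - b * c], which is nonzero. *)
    have /eqP : (1 - b * c) * r = 0.
      have -> : (1 - b * c) * r = (c * q + 1 * r) - c * (1 * q + b * r) by ring.
      by rewrite h3 h4 mulr0 subr0.
    by rewrite mulf_eq0 subr_eq0 eq_sym => /orP[/eqP|/eqP].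
  have q0 : q = 0 by move: h3; rewrite r0; lra.
  by subst q r; split; lra.
split.
  move=> b b0; apply: Der_evolution_eq0 => p q r s.
  move=> [[h1 h2] [h3 h4] [h5 h6]].
  have r0 : r = 0.
    (* This is [h6] with [d = 0]. *)
    have /eqP : b * r = 0 by lra.
    by rewrite mulf_eq0 => /orP[/eqP|/eqP].
  by subst r; split; lra.
split.
  rewrite eqEsubset; split=> [D /Der_evolutionP[[? ?] [? ?] [? ?]]|_ [t ->]].
    (* At [b = 0] the system reduces to $p = q = 0$ and $s = -r$, so [r] stays free. *)
    by exists (D 1 0); apply/mx22P; split; lra.
  by apply/Der_evolutionP; rewrite !mxE /=; do !split; lra.
(* The coefficients are now numerals, so the systems are linear; for [E3r], $2p = s$ and $2s = p$
   force $p = s = 0$. *)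
do 3![split; first by apply: Der_evolution_eq0 => p q r s [[? ?] [? ?] [? ?]];
  split; lra].
split; rewrite eqEsubset.
  split=> [D /Der_evolutionP[[? ?] [? ?] [? ?]]|_ [t ->]].
    by exists (D 1 0); apply/mx22P; split; lra.
  by apply/Der_evolutionP; rewrite !mxE /=; do !split; lra.
split=> [D /Der_evolutionP[[? ?] [? ?] [? ?]]|_ [t [s ->]]].
  (* Here the system says only $r = 0$ and $p = 2s$, which leaves [D 1 1] and [D 0 1] free. *)
  by exists (D 1 1), (D 0 1); apply/mx22P; split; lra.
by apply/Der_evolutionP; rewrite !mxE /=; do !split; lra.
Qed.
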